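(* Let $Q\in\mathcal{B}(\mathcal{H})^{Id}$ and let $J\in\mathcal{B}(\mathcal{H})$ be a symmetry. If $Q$ is a $J$-projection, then the following maximum and minimum with respect to $\preceq$ exist and are given by: (i) $\max_{\preceq}\{P: P\preceq Q,\ P\in\mathcal{P}(\mathcal{H}),\ P\text{ is a }J\text{-projection}\}=P_{R(Q)\cap R(Q^{*})}$; (ii) $\min_{\preceq}\{P: Q\preceq P,\ P\in\mathcal{P}(\mathcal{H}),\ P\text{ is a }J\text{-projection}\}=P_{N(Q+Q^{*})^{\perp}}$.
   Context: $\mathcal{H}$ is a separable complex Hilbert space; $\mathcal{B}(\mathcal{H})$ is the set of bounded linear operators on $\mathcal{H}$, $\mathcal{B}(\mathcal{H})^{Id}$ the set of all idempotents in it, and $\mathcal{P}(\mathcal{H})$ the set of all orthogonal projections. A symmetry is an operator $J\in\mathcal{B}(\mathcal{H})$ with $J=J^{*}=J^{-1}$. An idempotent $P$ is a $J$-projection if $P=JP^{*}J$. $N(T)$ and $R(T)$ denote the null space and range of $T$; $P_{\mathcal{M}}$ is the orthogonal projection onto a closed subspace $\mathcal{M}$. For idempotents $P,Q$ write $P\preceq Q$ if $PQ=QP=P$; this is a partial order on $\mathcal{B}(\mathcal{H})^{Id}$. *)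

(* Defs.v *)
From HB Require Import structures.
From mathcomp Require Import all_boot all_order all_algebra.
From mathcomp Require Import all_classical all_reals all_analysis.
From mathcomp Require Import complex.

Set Implicit Arguments.
Unset Strict Implicit.
Unset Printing Implicit Defensive.

Import Order.TTheory GRing.Theory Num.Theory.
Import numFieldNormedType.Exports.

Local Open Scope classical_set_scope.
Local Open Scope ring_scope.

(* The form is linear in its first argument and conjugate-linear in its
   second one; the norm of H takes its values in R[i] and is the one induced
   by the form. *)
HB.mixin Record CompleteNormedModule_isHilbert (R : realType) H
    of CompleteNormedModule R[i] H := {
  inner : {dot H for (@Num.conj R[i])} ;
  innerxx : forall x : H, inner x x = `|x| ^+ 2
}.

#[short(type="hilbertType")]
HB.structure Definition Hilbert (R : realType) :=
  {H of CompleteNormedModule R[i] H & CompleteNormedModule_isHilbert R H}.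

Definition separable_space (T : topologicalType) :=
  exists2 D : set T, countable D & dense D.

Section Operators.
Context {R : realType} {H : hilbertType R}.
Implicit Types (P Q T S J : H -> H) (M : set H) (A : set (H -> H)).

Local Notation "'[ x , y ]" := (inner x y).

Definition bounded_operator : set (H -> H) :=
  [set T | linear T /\ exists C : R[i], forall x, `|T x| <= C * `|x|].

(* By the Riesz representation theorem, a bounded operator has exactly one
   bounded adjoint; the default value 0 is only reached when T is not
   bounded. *)
Definition adjoint T : H -> H :=
  xget 0 [set S | bounded_operator S /\ forall x y, '[T x, y] = '[x, S y]].

Definition idempotent_operators : set (H -> H) :=
  [set P | bounded_operator P /\ P \o P = P].

Definition orth_projections : set (H -> H) :=
  [set P | idempotent_operators P /\ adjoint P = P].

Definition symmetry J := [/\ bounded_operator J, J = adjoint J & J \o J = id].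

Definition J_projection J P :=
  idempotent_operators P /\ P = J \o adjoint P \o J.

Definition null_space T : set H := [set x | T x = 0].

Definition orth_complement M : set H := [set x | forall y, M y -> '[x, y] = 0].

(* By the projection theorem, there is exactly one orthogonal projection of
   range M when M is a closed subspace; the default value 0 is only reached
   when M is not one. *)
Definition proj_onto M : H -> H :=
  xget 0 [set P | orth_projections P /\ range P = M].

Definition preceq P Q := P \o Q = P /\ Q \o P = P.

Definition is_max A P := A P /\ forall P', A P' -> preceq P' P.

Definition is_min A P := A P /\ forall P', A P' -> preceq P P'.

End Operators.

(* Main.v *)
(* Both subspaces are orthogonal complements, hence carry orthogonal projections,
   and both are J-invariant since QJ = JQ* and Q*J = JQ; a projection whose
   range is J-invariant commutes with J, so it is a J-projection. For (ii), the
   key fact is N(Q + Q* ) = N(Q) & N(Q* ), valid for every idempotent: if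
   w = Qx = - Q*x then Qw = w = Q*w, so <w, w> = <x, w> = - <x, w>. *)
Require Import Defs.
From mathcomp Require Import all_boot all_order all_algebra.
From mathcomp Require Import all_classical all_reals all_analysis.
From mathcomp Require Import complex ring.

Set Implicit Arguments.
Unset Strict Implicit.
Unset Printing Implicit Defensive.

Import Order.TTheory GRing.Theory Num.Theory.
Import numFieldNormedType.Exports.

Local Open Scope classical_set_scope.
Local Open Scope ring_scope.

(** * Inner products and the projection theorem *)

Section InnerProduct.
Context {R : realType} {H : hilbertType R}.
Implicit Types (x y z k m : H) (A M : set H).

Local Notation "'[ x , y ]" := (inner x y).

Lemma innerC x y : '[x, y] = ('[y, x])^*.
Proof. by rewrite hermC /= expr0 mul1r. Qed.

Lemma inner_eq0 x : '[x, x] = 0 -> x = 0.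
Proof. by rewrite innerxx => /eqP; rewrite expf_eq0 /= normr_eq0 => /eqP. Qed.

Lemma inner_inj x y : (forall z, '[x, z] = '[y, z]) -> x = y.
Proof.
by move=> xy; apply/subr0_eq/inner_eq0; rewrite linearBl /= xy subrr.
Qed.

Lemma innerZl (a : R[i]) x y : '[a *: x, y] = a * '[x, y].
Proof. exact: linearZl_LR. Qed.

Lemma innerZr (a : R[i]) x y : '[x, a *: y] = a^* * '[x, y].
Proof. exact: linearZr_LR. Qed.

(** Pythagoras: the subtracted vector is the orthogonal projection of [x] onto the line spanned by
    [k]. *)
Lemma normr_sub_inner x k : k != 0 ->
  `|x - ('[x, k] / `|k| ^+ 2) *: k| ^+ 2 =
  `|x| ^+ 2 - `|'[x, k]| ^+ 2 / `|k| ^+ 2.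
Proof.
move=> k0; have nk0 : `|k| ^+ 2 != 0 by rewrite expf_eq0 /= normr_eq0.
have kc : (`|k| ^+ 2)^* = `|k| ^+ 2 by rewrite conj_Creal // rpredX // normr_real.
rewrite -(innerxx (_ - _)) linearBl /= !linearBr /= !innerZl.
rewrite !innerZr !innerxx normCK (innerC k x) rmorphM fmorphV /=.
rewrite kc; move: nk0; move: (`|k| ^+ 2) '[x, k] (`|x| ^+ 2) => n c p n0.
by field.
Qed.

(* The vector [k] only sees how far [x] is from minimizing the distance to the
   line [k] spans; [d = 0] is the Cauchy-Schwarz inequality. *)
Lemma inner_le_almost_min x k (d e : R[i]) : 0 <= e ->
  (forall a : R[i], d <= `|x - a *: k| ^+ 2) -> `|x| ^+ 2 <= d + e ^+ 2 ->
  `|'[x, k]| <= e * `|k|.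
Proof.
move=> e0 dmin xde; have [->|k0] := eqVneq k 0.
  by rewrite linear0r !normr0 mulr0.
have nk : 0 < `|k| ^+ 2 by rewrite exprn_gt0 // normr_gt0.
rewrite -ler_sqr ?nnegrE ?mulr_ge0 // exprMn -ler_pdivrMr //.
have := dmin ('[x, k] / `|k| ^+ 2); rewrite normr_sub_inner // => dle.
by rewrite -(lerD2l d) (le_trans _ xde) // -lerBrDr.
Qed.

Lemma Cauchy_Schwarz x y : `|'[x, y]| <= `|x| * `|y|.
Proof.
apply: (inner_le_almost_min (d := 0)) => [//|a|]; last by rewrite add0r.
exact: exprn_ge0.
Qed.

Lemma orth_complementP A a x y :
  orth_complement A x -> orth_complement A y -> orth_complement A (a *: x + y).
Proof.
by move=> Ax Ay z Az; rewrite linearDl /= innerZl Ax // Ay // mulr0 addr0.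
Qed.

Lemma orth_complement0 A : orth_complement A 0.
Proof. by move=> z _; rewrite linear0l. Qed.

Lemma orth_complementZ A a x : orth_complement A x -> orth_complement A (a *: x).
Proof.
by move=> Ax; rewrite -[_ *: _]addr0; apply: orth_complementP => //;
  exact: orth_complement0.
Qed.

Lemma orth_complementD A x y :
  orth_complement A x -> orth_complement A y -> orth_complement A (x + y).
Proof. by move=> Ax Ay; rewrite -[x]scale1r; apply: orth_complementP. Qed.

Lemma orth_complementB A x y :
  orth_complement A x -> orth_complement A y -> orth_complement A (x - y).
Proof.
by move=> Ax Ay; rewrite -scaleN1r addrC; apply: orth_complementP.
Qed.

(** [d] is the squared distance from [x] to [M]. The infimum is taken in [R], through real parts,
    because the order of [R[i]] is only partial. *)
Lemma normr_sqr_inf M x : M 0 -> exists d : R[i],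
  (forall m, M m -> d <= `|x - m| ^+ 2) /\
  (forall e, 0 < e -> exists2 m, M m & `|x - m| ^+ 2 < d + e).
Proof.
move=> M0; pose f m : R := complex.Re (`|x - m| ^+ 2).
have fE m : (f m)%:C%C = `|x - m| ^+ 2.
  by rewrite RRe_real // rpredX // normr_real.
have lb : has_lbound (f @` M).
  by exists 0 => _ [m _ <-]; rewrite -lecR fE exprn_ge0.
exists (inf (f @` M))%:C%C; split=> [m Mm|e e0].
  by rewrite -fE lecR; apply: ge_inf => //; exists m.
have eE : (complex.Re e)%:C%C = e by rewrite RRe_real // gtr0_real.
have e0' : 0 < complex.Re e by rewrite -ltcR eE.
have [|_ [m Mm <-]] := inf_adherent e0' (E := f @` M).
  by split=> //; exists (f 0), 0.
by exists m => //; rewrite -fE -eE -rmorphD ltcR.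
Qed.

Lemma small_eq0 (V : normedZmodType R[i]) (u : V) (c : R[i]) :
  (forall e, 0 < e -> `|u| <= e * c) -> u = 0.
Proof.
move=> small; apply/eqP; rewrite -normr_le0; apply/ler_addgt0Pr => e e0.
rewrite add0r; have c0 : 0 <= c.
  by rewrite -[c]mul1r; apply: le_trans (small 1 ltr01).
have c1 : 0 < c + 1 by rewrite ltr_wpDl.
(* Dividing by [c + 1] also covers the case [c = 0]. *)
apply: le_trans (small (e / (c + 1)) _) _; first exact: divr_gt0.
by rewrite mulrAC ler_pdivrMr // ler_pM2l // lerDl.
Qed.

Lemma projection_theorem A x :
  exists2 y, orth_complement A y & forall k, orth_complement A k -> '[x - y, k] = 0.
Proof.
(* Approximate minimizers of the distance to [x] form a Cauchy filter: by
   [almost_orth], the difference of two of them is almost orthogonal to itself. *)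
set M := orth_complement A.
have [d [dmin dinf]] := normr_sqr_inf x (@orth_complement0 A).
pose B (e : R[i]) := [set m | M m /\ `|x - m| ^+ 2 < d + e ^+ 2].
pose F := filter_from [set e : R[i] | 0 < e] B.
have almost_orth e m k : 0 < e -> B e m -> M k -> `|'[x - m, k]| <= e * `|k|.
  move=> e0 [Mm me] Mk; apply: (inner_le_almost_min (d := d)); last exact: ltW.
    exact: ltW.
  move=> a; rewrite -addrA -opprD; apply: dmin.
  by apply: orth_complementD => //; apply: orth_complementZ.
have B_mono e e' : 0 < e -> e <= e' -> B e `<=` B e'.
  move=> e0 ee' m [Mm me]; split=> //; apply: (lt_le_trans me).
  by rewrite lerD2l ler_sqr // nnegrE ltW // (lt_le_trans e0).
have Fproper : ProperFilter F.
  apply: filter_from_proper; last first.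
    by move=> e e0; have [m ? ?] := dinf _ (exprn_gt0 2 e0); exists m.
  apply: filter_from_filter; first by exists 1 => /=.
  move=> e1 e2 /= e10 e20.
  (* Positive elements of [R[i]] are real, hence comparable. *)
  have /orP[e12|e21] : e1 >=< e2 by apply: real_comparable; rewrite gtr0_real.
    by exists e1 => // m Bm; split=> //; exact: B_mono Bm.
  by exists e2 => // m Bm; split=> //; exact: B_mono Bm.
have Fcauchy : cauchy F.
  apply/cauchy_ballP => e e0 /=.
  have e30 : 0 < e / 3 by rewrite divr_gt0.
  exists (B (e / 3), B (e / 3)); first by split; exists (e / 3).
  move=> [m m'] /= [Bm Bm']; rewrite -ball_normE /ball_ /=.
  have Mmm' : M (m - m') by apply: orth_complementB; [case: Bm|case: Bm'].
  apply: (@le_lt_trans _ _ (e / 3 + e / 3)); last first.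
    by rewrite -subr_gt0; have -> : e - (e / 3 + e / 3) = e / 3 by field.
  have [->|mm'] := eqVneq (m - m') 0; first by rewrite normr0 addr_ge0 // ltW.
  have mE : m - m' = (x - m') - (x - m).
    by rewrite opprB [RHS]addrC addrA addrNK.
  rewrite -(ler_pM2r (x := `|m - m'|)) ?normr_gt0 // -expr2 -innerxx.
  rewrite -[X in X <= _]ger0_norm ?innerxx ?exprn_ge0 // -innerxx.
  rewrite {1}mE linearBl /= mulrDl.
  by apply: le_trans (ler_normB _ _) _; rewrite lerD // almost_orth.
have [y Fy] : exists y, F --> y.
  by exists (lim F); exact: cauchy_cvg.
have near_y e : 0 < e -> exists2 m, B e m & `|y - m| < e.
  move=> e0; have FB : F (B e) by exists e.
  have Fb : F (ball y e) by apply: Fy; apply: nbhsx_ballx.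
  have [m [Bm]] := filter_ex (filterI FB Fb).
  by rewrite -ball_normE; exists m.
exists y.
  (* [M] is closed: pairing [y] with [a] is pairing [y - m] with [a], which Cauchy-Schwarz makes
     arbitrarily small. *)
  move=> a Aa; apply: (small_eq0 (c := `|a|)) => e e0.
  have [m [Mm _] ym] := near_y e e0.
  have -> : '[y, a] = '[y - m, a] by rewrite linearBl /= Mm // subr0.
  by apply: le_trans (Cauchy_Schwarz _ _) _; rewrite ler_wpM2r // ltW.
move=> k Mk; apply: (small_eq0 (c := `|k| + `|k|)) => e e0.
have [m Bm ym] := near_y e e0.
(* The first term is almost orthogonal to [k], the second has small norm. *)
have -> : x - y = (x - m) - (y - m) by rewrite opprB addrA addrNK.
rewrite linearBl /= mulrDr; apply: le_trans (ler_normB _ _) _.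
rewrite lerD ?almost_orth //.
by apply: le_trans (Cauchy_Schwarz _ _) _; rewrite ler_wpM2r // ltW.
Qed.

End InnerProduct.

(** * Adjoint pairs and orthogonal projections *)

Section Adjoints.
Context {R : realType} {H : hilbertType R}.
Implicit Types (P Q J S T : H -> H) (A M : set H).

Local Notation "'[ x , y ]" := (inner x y).

(** The bare algebraic relation, free of boundedness and of the default value in [adjoint]; it still
    determines [T] from [S]. *)
Definition adjoint_pair S T := forall x y, '[S x, y] = '[x, T y].

Lemma adjoint_pair_sym S T : adjoint_pair S T -> adjoint_pair T S.
Proof. by move=> ST x y; rewrite innerC -ST -innerC. Qed.

Lemma adjoint_pair_inj S T T' :
  adjoint_pair S T -> adjoint_pair S T' -> T = T'.
Proof.
move=> /adjoint_pair_sym ST /adjoint_pair_sym ST'.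
by apply/funext => x; apply: inner_inj => z; rewrite ST ST'.
Qed.

Lemma adjoint_pair_comp S S' T T' : adjoint_pair S S' -> adjoint_pair T T' ->
  adjoint_pair (S \o T) (T' \o S').
Proof. by move=> SS' TT' x y /=; rewrite SS' TT'. Qed.

Lemma adjoint_eq T S :
  bounded_operator S -> adjoint_pair T S -> adjoint T = S.
Proof.
move=> bS TS; rewrite /adjoint; case: xgetP => [U -> [_ TU]|/(_ S) []//].
exact: adjoint_pair_inj TU TS.
Qed.

Lemma adjoint_pairP T : adjoint_pair T (adjoint T) \/ adjoint T = 0.
Proof.
by rewrite /adjoint; case: xgetP => [U -> [_ TU]|_]; [left|right].
Qed.

Lemma adjoint_pair_self T : adjoint T = T -> adjoint_pair T T.
Proof.
move=> TT; have [|T0] := adjoint_pairP T; first by rewrite TT.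
by rewrite -TT T0 => x y; rewrite linear0l linear0r.
Qed.

Lemma symmetry_adjoint_pair J : symmetry J -> adjoint_pair J J.
Proof. by move=> [_ /esym/adjoint_pair_self]. Qed.

(* Riesz representation is not needed: were [adjoint Q] the default value 0,
   then [Q = J \o 0 \o J] would vanish, and 0 is its own adjoint. *)
Lemma J_projection_adjoint_pair J Q :
  symmetry J -> J_projection J Q -> adjoint_pair Q (adjoint Q).
Proof.
move=> /symmetry_adjoint_pair JJ [_ QJ].
have [//|Q0] := adjoint_pairP Q.
have J0 : J 0 = 0 by apply: inner_inj => z; rewrite JJ !linear0l.
by rewrite Q0 QJ Q0 => x y /=; rewrite J0 linear0l linear0r.
Qed.

Lemma orth_projection_range P x : orth_projections P -> range P x -> P x = x.
Proof. by move=> [[_ PP] _] [y _ <-]; rewrite -[LHS]/((P \o P) y) PP. Qed.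

(** Taking adjoints reverses a product; this yields one half of a [preceq] relation from the
    other. *)
Lemma adjoint_comp_eq S S' T T' U U' :
  adjoint_pair S S' -> adjoint_pair T T' -> adjoint_pair U U' ->
  S \o T = U -> T' \o S' = U'.
Proof.
move=> SS' TT' UU' STU; apply: adjoint_pair_inj UU'.
by rewrite -STU; apply: adjoint_pair_comp.
Qed.

Lemma orth_projection_comp P T : orth_projections P ->
  (forall x, range P (T x)) -> P \o T = T.
Proof. by move=> oP PT; apply/funext => x /=; rewrite orth_projection_range. Qed.

(** Invariance of the range says [PJP = JP]; its adjoint is [PJP = PJ], so [P] and [J] commute and
    [JPJ = P]. *)
Lemma J_projection_orth J P : symmetry J -> orth_projections P ->
  (forall x, range P x -> range P (J x)) -> J_projection J P.
Proof.
move=> sJ oP JP; split; first by case: oP.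
have [_ aP] := oP; rewrite aP.
have JJ := symmetry_adjoint_pair sJ; have PP := adjoint_pair_self aP.
have JPc := adjoint_pair_comp JJ PP.
have PJP : P \o (J \o P) = J \o P.
  by apply: orth_projection_comp => // x; apply: JP; exists x.
have PJP' := adjoint_comp_eq PP JPc JPc PJP.
have comm : P \o J = J \o P by rewrite -PJP -PJP'.
by case: sJ => _ _ J2; rewrite -comm -compA J2.
Qed.

Lemma proj_onto_orth_complement A :
  let P := proj_onto (orth_complement A) in
  orth_projections P /\ range P = orth_complement A.
Proof.
set M := orth_complement A.
have [x|P PM] := @choice _ _ (fun x y => M y /\ forall k, M k -> '[x - y, k] = 0).
  by have [y My xy] := projection_theorem A x; exists y.
have P1 x : M (P x) by case: (PM x).
(* Self-adjointness, linearity and the bound 1 all follow from this identity. *)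
have P2 x k : M k -> '[P x, k] = '[x, k].
  by move=> Mk; apply/esym/subr0_eq; rewrite -linearBl /= (PM x).2.
have Pid m : M m -> P m = m.
  move=> Mm; apply/subr0_eq/inner_eq0.
  have MPm : M (P m - m) by apply: orth_complementB; [exact: P1|].
  by rewrite linearBl /= P2 // subrr.
have PP : adjoint_pair P P.
  by move=> x y; rewrite innerC -(P2 y) // -innerC P2.
have bP : bounded_operator P.
  split=> [a x y|].
    apply: inner_inj => z.
    by rewrite linearDl /= innerZl !PP linearDl /= innerZl.
  exists 1 => x; rewrite mul1r; have [->|Px0] := eqVneq (P x) 0.
    by rewrite normr0.
  rewrite -(ler_pM2r (x := `|P x|)) ?normr_gt0 // -expr2 -innerxx P2 //.
  apply: le_trans (Cauchy_Schwarz _ _); rewrite ger0_norm //.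
  by rewrite -P2 // innerxx exprn_ge0.
rewrite /proj_onto; case: xgetP => [_ _ //|/(_ P)[]]; split.
  split; last exact: adjoint_eq.
  by split=> //; apply/funext => x /=; rewrite Pid.
by apply/seteqP; split=> [_ [x _ <-]//|m Mm]; exists m => //; rewrite Pid.
Qed.

Lemma null_space_add_adjoint Q S x : Q \o Q = Q -> adjoint_pair Q S ->
  Q x + S x = 0 -> Q x = 0 /\ S x = 0.
Proof.
move=> QQ QS.
have SS : S \o S = S by apply: adjoint_comp_eq QQ.
have SQ := adjoint_pair_sym QS.
move=> /eqP; rewrite addr_eq0 => /eqP Qx.
have Sx : S x = - Q x by rewrite Qx opprK.
have QSx : S (Q x) = Q x.
  (* [S] is known only through its pairing with [Q], so oddness is read off from there. *)
  have S0 : forall z, S (- z) = - S z.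
    by move=> z; apply: inner_inj => t; rewrite SQ !linearNl /= SQ.
  by rewrite Qx S0 -[S (S x)]/((S \o S) x) SS.
have QQx : Q (Q x) = Q x by rewrite -[LHS]/((Q \o Q) x) QQ.
have w1 : '[Q x, Q x] = '[x, Q x] by rewrite QS QSx.
have w2 : '[Q x, Q x] = - '[x, Q x].
  by rewrite {1}Qx linearNl /= SQ QQx.
have Q0 : Q x = 0.
  apply: inner_eq0; move/eqP: w2.
  by rewrite -w1 -addr_eq0 -mulr2n mulrn_eq0 => /eqP.
by split=> //; rewrite Sx Q0 oppr0.
Qed.

End Adjoints.

Theorem corollary3p4 (R : realType) (H : hilbertType R)
    (H_separable : separable_space H) (Q J : H -> H) :
  idempotent_operators Q -> symmetry J -> J_projection J Q ->
  is_max [set P : H -> H | [/\ preceq P Q, orth_projections P & J_projection J P]]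
    (proj_onto (range Q `&` range (adjoint Q))) /\
  is_min [set P : H -> H | [/\ preceq Q P, orth_projections P & J_projection J P]]
    (proj_onto (orth_complement (null_space (Q \+ adjoint Q)))).
Proof.
move=> [[Qlin _] QQ] sJ JQ.
have QS := J_projection_adjoint_pair sJ JQ; set S := adjoint Q in QS *.
have SQ := adjoint_pair_sym QS.
have SS : S \o S = S by apply: adjoint_comp_eq QQ.
have J2 x : J (J x) = x by case: sJ => _ _ J2; rewrite -[LHS]/((J \o J) x) J2.
have JJ := symmetry_adjoint_pair sJ.
have QJ x : Q (J x) = J (S x) by rewrite JQ.2 /= J2.
have SJ x : S (J x) = J (Q x) by rewrite JQ.2 /= J2.
have QQx x : Q (Q x) = Q x by rewrite -[LHS]/((Q \o Q) x) QQ.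
have SSx x : S (S x) = S x by rewrite -[LHS]/((S \o S) x) SS.
have rangeE x : (range Q `&` range S) x <-> Q x = x /\ S x = x.
  split=> [[[y _ <-] [z _ yz]]|[Qx Sx]]; last by split; exists x.
  by rewrite QQx -yz SSx.
split.
  (* A vector [x] is orthogonal to every [y - S y] exactly when [Q x = x], and to every [y - Q y]
     exactly when [S x = x]. *)
  have MA : range Q `&` range S =
      orth_complement (range (fun y => y - S y) `|` range (fun y => y - Q y)).
    apply/seteqP; split=> x.
      move=> /rangeE[Qx Sx] _ [|] [y _ <-]; rewrite linearBr /=.
        by rewrite -QS Qx subrr.
      by rewrite -SQ Sx subrr.
    move=> xA; apply/rangeE; split; apply: inner_inj => z.
      rewrite QS; apply/esym/subr0_eq; rewrite -linearBr /=.
      by apply: xA; left; exists z.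
    rewrite SQ; apply/esym/subr0_eq; rewrite -linearBr /=.
    by apply: xA; right; exists z.
  rewrite MA; have [] := proj_onto_orth_complement
    (range (fun y => y - S y) `|` range (fun y => y - Q y)).
  rewrite -MA; set P := proj_onto _ => oP rP.
  have PP := adjoint_pair_self oP.2.
  have fixP x : Q (P x) = P x /\ S (P x) = P x.
    by apply/rangeE; rewrite -rP; exists x.
  split=> [|P' [[P'Q QP'] oP' _]].
    split=> //; first split.
    - apply: (adjoint_comp_eq SQ PP PP).
      by apply/funext => x /=; rewrite (fixP x).2.
    - by apply/funext => x /=; rewrite (fixP x).1.
    apply: J_projection_orth => // x; rewrite rP => /rangeE[Qx Sx].
    by apply/rangeE; rewrite QJ SJ Qx Sx.
  have P'P' := adjoint_pair_self oP'.2.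
  (* With [QP'], this puts the range of [P'] inside both ranges. *)
  have SP' : S \o P' = P' by apply: adjoint_comp_eq P'Q.
  have PP'c : P \o P' = P'.
    apply: orth_projection_comp => // x; rewrite rP; apply/rangeE.
    by rewrite -[Q _]/((Q \o P') x) -[S _]/((S \o P') x) QP' SP'.
  by split=> //; apply: adjoint_comp_eq PP'c.
set N := null_space _.
have NE x : N x <-> Q x = 0 /\ S x = 0.
  split; first exact: null_space_add_adjoint.
  by move=> [Qx Sx]; rewrite /N /null_space /= Qx Sx addr0.
have [] := proj_onto_orth_complement N; set P := proj_onto _ => oP rP.
have PP := adjoint_pair_self oP.2.
(* The range of [Q] is orthogonal to the kernel of [S], hence to [N]. *)
have PQ : P \o Q = Q.
  apply: orth_projection_comp => // x; rewrite rP => y /NE[_ Sy].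
  by rewrite QS Sy linear0r.
have PS : P \o S = S.
  apply: orth_projection_comp => // x; rewrite rP => y /NE[Qy _].
  by rewrite SQ Qy linear0r.
have QP : Q \o P = Q by apply: adjoint_comp_eq PS.
split=> [|P' [[QP' P'Q] oP' _]].
  (* [J] exchanges the kernels of [Q] and [S], so it preserves [N] and, being self-adjoint, its
     orthogonal complement. *)
  split=> //; apply: J_projection_orth => // x; rewrite rP => Nx y /NE[Qy Sy].
  have J0 : J 0 = 0 by apply: inner_inj => z; rewrite JJ !linear0l.
  by rewrite JJ; apply: Nx; apply/NE; rewrite QJ SJ Qy Sy J0.
have P'P' := adjoint_pair_self oP'.2.
have P'S : P' \o S = S by apply: adjoint_comp_eq QP'.
have P'P'x x : P' (P' x) = P' x by rewrite -[LHS]/((P' \o P') x) oP'.1.2.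
have P'P : P' \o P = P.
  apply: orth_projection_comp => // x.
  have Nx : orth_complement N (P x) by rewrite -rP; exists x.
  move: (P x) Nx => {}x Nx; exists x => //.
  (* [P'] fixes the ranges of [Q] and [S], so [x - P' x] lies in both kernels. It is then orthogonal
     to [x], and also to [P' x], hence to itself. *)
  have Nd : N (x - P' x).
    apply/NE; split; apply: inner_inj => z; rewrite linear0l.
      by rewrite QS linearBl /= P'P' -[P' (S z)]/((P' \o S) z) P'S subrr.
    by rewrite SQ linearBl /= P'P' -[P' (Q z)]/((P' \o Q) z) P'Q subrr.
  apply/esym/subr0_eq/inner_eq0; rewrite {1}linearBl /= Nx // sub0r.
  by rewrite linearBr /= [X in _ - X]P'P' P'P'x P'P' subrr oppr0.
split=> //; exact: adjoint_comp_eq P'P.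
Qed.
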